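(* Let $\mathbf M=(M,+,\cdot,\vec 0)$ be a semimodule over a commutative semiring $(S,\oplus,\cdot,0,1)$ with a fixed basis $(\vec b_i)_{i\in I}$. Then $\mathbf L_s(\mathbf M)=(L_s(\mathbf M),\subseteq,{}^\perp,\{\vec 0\},M)$ is an orthoposet.
   Context: A commutative semiring is an algebra $(S,\oplus,\cdot,0,1)$ such that $(S,\oplus,0)$ and $(S,\cdot,1)$ are commutative monoids, $(x\oplus y)z=xz\oplus yz$ and $x0=0$ for all $x,y,z\in S$. A semimodule over it is $(M,+,\cdot,\vec 0)$ with $\cdot:S\times M\to M$ such that $(M,+,\vec 0)$ is a commutative monoid and for all $\vec x,\vec y\in M$, $a,b\in S$: $a(\vec x+\vec y)=a\vec x+a\vec y$, $(a\oplus b)\vec x=a\vec x+b\vec x$, $(ab)\vec x=a(b\vec x)$, $1\vec x=\vec x$, $0\vec x=a\vec 0=\vec 0$. Basis: a family $(\vec b_i)_{i\in I}$ of elements of $M$, $I$ a non-empty set, such that for every $\vec x\in M$ there is exactly one function $f:I\to S$ with $f(i)=0$ for all but finitely many $i$ and $\sum_{i\in I}f(i)\vec b_i=\vec x$; the coordinates of $\vec x$ are $x_i:=f(i)$. The inner product is $\vec x\vec y:=\sum_{i\in I}x_iy_i\in S$ (sum with respect to $\oplus$). Write $\vec x\perp\vec y$ if $\vec x\vec y=0$, and for $C\subseteq M$ put $C^\perp:=\{\vec x\in M\mid\vec x\perp\vec y\text{ for all }\vec y\in C\}$. A subsemimodule is a subset $U\subseteq M$ containing $\vec 0$ and closed under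 $+$ and under multiplication by elements of $S$. It is called splitting if $U+U^\perp=M$ and $U\cap U^\perp=\{\vec 0\}$, where $U+W:=\{\vec x+\vec y\mid \vec x\in U,\vec y\in W\}$. $L_s(\mathbf M)$ is the set of all splitting subsemimodules. An orthoposet is a bounded poset $(X,\leq,{}',0,1)$ with a unary operation $'$ that is an antitone involution ($x\leq y$ implies $y'\leq x'$; $x''=x$) and a complementation ($\sup(x,x')=1$ and $\inf(x,x')=0$ for all $x\in X$). *)

(* Defs.v *)
From HB Require Import structures.
From mathcomp Require Import all_boot all_order all_algebra.
From mathcomp Require Import boolp classical_sets functions cardinality fsbigop.

Set Implicit Arguments.
Unset Strict Implicit.
Unset Printing Implicit Defensive.

Import GRing.Theory.
Local Open Scope classical_set_scope.
Local Open Scope ring_scope.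

(* The semirings are [comPzSemiRingType]s: unlike [comNzSemiRingType], this
   structure does not impose 0 <> 1. *)
Section InnerProduct.
Context {S : comPzSemiRingType} {M : lSemiModType S} {I : choiceType}.
Implicit Types (b : I -> M) (x y : M) (f : I -> S) (U W C : set M).

(* Finiteness of the support must be required explicitly: the library's
   finitely supported sum is 0 when infinitely many terms are nonzero. *)
Definition is_coordinates b x f : Prop :=
  finite_set [set i | f i <> 0] /\ \sum_(i \in [set: I]) f i *: b i = x.

Definition is_basis b : Prop :=
  [set: I] !=set0 /\ forall x, exists! f, is_coordinates b x f.

(* The default value is irrelevant when b is a basis. *)
Definition coordinates b x : I -> S := xget (fun=> 0) (is_coordinates b x).

Definition inner b x y : S :=
  \sum_(i \in [set: I]) coordinates b x i * coordinates b y i.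

Definition orthogonal b x y : Prop := inner b x y = 0.

Definition perp b C : set M := [set x | forall y, C y -> orthogonal b x y].

Definition addset U W : set M := [set x + y | x in U & y in W].

Definition splitting b U : Prop :=
  [/\ GRing.subsemimod_closed [in U],
      addset U (perp b U) = setT & U `&` perp b U = [set 0]].

Definition Ls b : set (set M) := [set U | splitting b U].

End InnerProduct.

(* Order-theoretic notions on a subset X of an ambient type T: suprema and
   infima are computed among the elements of X only. *)
Section Orthoposet.
Context {T : Type}.
Implicit Types (X : set T) (le : T -> T -> Prop) (compl : T -> T).

Definition is_poset X le : Prop :=
  [/\ forall x, X x -> le x x,
      forall x y, X x -> X y -> le x y -> le y x -> x = y &
      forall x y z, X x -> X y -> X z -> le x y -> le y z -> le x z].

Definition is_bounded_poset X le (bot top : T) : Prop :=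
  [/\ is_poset X le, X bot, X top &
      forall x, X x -> le bot x /\ le x top].

Definition is_sup2 X le (x y s : T) : Prop :=
  [/\ X s, le x s, le y s &
      forall z, X z -> le x z -> le y z -> le s z].

Definition is_inf2 X le (x y m : T) : Prop :=
  [/\ X m, le m x, le m y &
      forall z, X z -> le z x -> le z y -> le z m].

Record is_orthoposet X le compl (bot top : T) : Prop := {
  orthoposet_bounded : is_bounded_poset X le bot top;
  orthoposet_closed : forall x, X x -> X (compl x);
  orthoposet_antitone :
    forall x y, X x -> X y -> le x y -> le (compl y) (compl x);
  orthoposet_involution : forall x, X x -> compl (compl x) = x;
  orthoposet_sup : forall x, X x -> is_sup2 X le x (compl x) top;
  orthoposet_inf : forall x, X x -> is_inf2 X le x (compl x) bot
}.

End Orthoposet.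

(* Main.v *)
Require Import Defs.
From HB Require Import structures.
From mathcomp Require Import all_boot all_order all_algebra.
From mathcomp Require Import boolp classical_sets functions cardinality fsbigop.

Set Implicit Arguments.
Unset Strict Implicit.
Unset Printing Implicit Defensive.

Import GRing.Theory.
Local Open Scope classical_set_scope.
Local Open Scope ring_scope.

(** The crux is that U^perp^perp is contained in U for splitting U.  Write x in
    U^perp^perp as u + v with u in U and v in U^perp.  Pairing with any y in
    U^perp gives 0 = xy = uy + vy = vy, so v is orthogonal to U^perp; it is also
    orthogonal to U, hence to U + U^perp = M.  Since v b_i is the i-th coordinate
    of v, this forces v = 0 and x = u; no subtraction is needed. *)

(** Only nonzero terms contribute, so [A] may even be infinite. This brings sums with different
    supports to one common index set, where they can be compared. *)
Lemma fsum_support {I : choiceType} {V : nmodType} (A : set I) (F : I -> V) :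
  (forall i, ~ A i -> F i = 0) ->
  \sum_(i \in [set: I]) F i = \sum_(i \in A) F i.
Proof. by move=> F0; apply/esym/fsbig_widen => // i [_ /F0]. Qed.

Section Basis.
Context {S : comPzSemiRingType} {M : lSemiModType S} {I : choiceType}.
Variables (b : I -> M) (hb : is_basis b).
Implicit Types (x y z : M) (U C : set M) (f : I -> S).

Local Notation coord := (coordinates b).

Lemma coordinatesP x : is_coordinates b x (coord x).
Proof. by have [f [bf _]] := hb.2 x; apply: xgetPex; exists f. Qed.

Lemma coordinates_unique x f : is_coordinates b x f -> coord x = f.
Proof.
have [g [_ g_uniq]] := hb.2 x => bf.
by rewrite -(g_uniq _ bf) -(g_uniq _ (coordinatesP x)).
Qed.

Lemma finite_coordinates x : finite_set [set i | coord x i <> 0].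
Proof. by case: (coordinatesP x). Qed.

Lemma coordinatesD x y : coord (x + y) = (fun i => coord x i + coord y i).
Proof.
apply: coordinates_unique.
(* Nonzero coordinates may add up to 0, so the support of the sum can be smaller than [A]; what
   matters is that [A] is finite and all three sums restrict to it. *)
pose A := [set i | coord x i <> 0] `|` [set i | coord y i <> 0].
have finA : finite_set A by rewrite finite_setU; split; exact: finite_coordinates.
have A0 i : ~ A i -> coord x i = 0 /\ coord y i = 0.
  by move=> /not_orP[/contrapT ? /contrapT ?].
split.
  apply: sub_finite_set finA => i /= nz; apply: contrapT => /A0[x0 y0].
  by apply: nz; rewrite x0 y0 addr0.
rewrite -[in RHS](coordinatesP x).2 -[in RHS](coordinatesP y).2.
rewrite !(@fsum_support _ _ A); first last.
- by move=> i /A0[-> ->]; rewrite addr0 scale0r.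
- by move=> i /A0[-> _]; rewrite scale0r.
- by move=> i /A0[_ ->]; rewrite scale0r.
by rewrite -fsbig_split//; apply: eq_fsbigr => i _; rewrite scalerDl.
Qed.

Lemma coordinatesZ a x : coord (a *: x) = (fun i => a * coord x i).
Proof.
apply: coordinates_unique.
pose A := [set i | coord x i <> 0].
have A0 i : ~ A i -> coord x i = 0 by move/contrapT.
split.
  apply: sub_finite_set (finite_coordinates x) => i /= nz x0.
  by apply: nz; rewrite x0 mulr0.
rewrite -[in RHS](coordinatesP x).2 !(@fsum_support _ _ A); first last.
- by move=> i /A0 ->; rewrite mulr0 scale0r.
- by move=> i /A0 ->; rewrite scale0r.
have finA : finite_set A := finite_coordinates x.
by rewrite !fsbig_finite// scaler_sumr; apply: eq_bigr => i _; rewrite scalerA.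
Qed.

Lemma coordinates0 : coord 0 = (fun=> 0).
Proof.
by rewrite -(scale0r (0 : M)) coordinatesZ; apply/funext => i; rewrite mul0r.
Qed.

Lemma coordinates_basis j : coord (b j) = (fun i => (i == j)%:R).
Proof.
apply: coordinates_unique; split.
  (* Only an inclusion in [[set j]] is claimed: the support is empty when 0 = 1 in [S]. *)
  apply: sub_finite_set (finite_set1 j) => i /=.
  by case: eqP.
rewrite (@fsum_support _ _ [set j]) ?fsbig_set1 ?eqxx ?scale1r// => i /eqP.
by move=> /negPf ->; rewrite scale0r.
Qed.

Lemma innerC x y : inner b x y = inner b y x.
Proof. by apply: eq_fsbigr => i _; rewrite mulrC. Qed.

Lemma inner0l x : inner b 0 x = 0.
Proof. by rewrite /inner coordinates0 fsbig1// => i _; rewrite mul0r. Qed.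

Lemma innerDl x y z : inner b (x + y) z = inner b x z + inner b y z.
Proof.
(* Every term of the three sums has a coordinate of [z] as a factor, so the finite support of [z]
   serves them all. *)
pose A := [set i | coord z i <> 0].
have A0 i : ~ A i -> coord z i = 0 by move/contrapT.
rewrite /inner coordinatesD !(@fsum_support _ _ A);
  do ?by move=> i /A0 ->; rewrite mulr0.
rewrite -fsbig_split; last exact: finite_coordinates.
by apply: eq_fsbigr => i _; rewrite mulrDl.
Qed.

Lemma innerZl a x y : inner b (a *: x) y = a * inner b x y.
Proof.
pose A := [set i | coord y i <> 0].
have A0 i : ~ A i -> coord y i = 0 by move/contrapT.
have finA : finite_set A := finite_coordinates y.
rewrite /inner coordinatesZ !(@fsum_support _ _ A);
  do ?by move=> i /A0 ->; rewrite mulr0.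
by rewrite !fsbig_finite// mulr_sumr; apply: eq_bigr => i _; rewrite mulrA.
Qed.

Lemma inner_basisr x j : inner b x (b j) = coord x j.
Proof.
rewrite /inner coordinates_basis (@fsum_support _ _ [set j]).
  by rewrite fsbig_set1 eqxx mulr1.
by move=> i /eqP/negPf ->; rewrite mulr0.
Qed.

(** Testing against the basis vectors shows that all coordinates of [x] vanish. *)
Lemma inner_nondegenerate x : (forall y, Defs.orthogonal b x y) -> x = 0.
Proof.
move=> x0; rewrite -(coordinatesP x).2 fsbig1// => i _.
by rewrite -inner_basisr x0 scale0r.
Qed.

Lemma perp_subsemimod C : GRing.subsemimod_closed [in perp b C].
Proof.
split; first split; rewrite ?inE.
- by move=> y _; exact: inner0l.
- move=> x y; rewrite !inE => Cx Cy z Cz.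
  by rewrite /Defs.orthogonal innerDl Cx// Cy// addr0.
- move=> a x; rewrite !inE => Cx z Cz.
  by rewrite /Defs.orthogonal innerZl Cx// mulr0.
Qed.

Lemma subset_perpK C : C `<=` perp b (perp b C).
Proof. by move=> x Cx y /(_ _ Cx); rewrite /Defs.orthogonal innerC. Qed.

Lemma perp_antitone U C : U `<=` C -> perp b C `<=` perp b U.
Proof. by move=> UC x Cx y /UC; exact: Cx. Qed.

Lemma splitting_perpK U : splitting b U -> perp b (perp b U) = U.
Proof.
move=> [_ sumU _]; apply/seteqP; split=> [x x_perp|]; last exact: subset_perpK.
have : [set: M] x by [].
rewrite -sumU => -[u Uu [v Uv uvx]].
suff v0 : v = 0 by rewrite -uvx v0 addr0.
apply: inner_nondegenerate => y.
have : [set: M] y by [].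
(* Since [v] is orthogonal to [y1] in U, only the product of [v] and [y2] remains. *)
rewrite -sumU => -[y1 Uy1 [y2 Uy2 <-]].
rewrite /Defs.orthogonal innerC innerDl innerC (Uv _ Uy1) add0r innerC.
(* Here [y2] lies in U^perp, so 0 = x y2 = u y2 + v y2 = v y2. *)
have := x_perp _ Uy2.
by rewrite /Defs.orthogonal -uvx innerDl innerC (Uy2 _ Uu) add0r.
Qed.

(** As U^perp^perp = U, both splitting conditions for U^perp are those for U with the two
    subsemimodules exchanged. *)
Lemma splitting_perp U : splitting b U -> splitting b (perp b U).
Proof.
move=> sU; have [_ sumU capU] := sU.
split; first exact: perp_subsemimod.
- rewrite splitting_perpK//; apply/seteqP; split=> // x _.
  have : [set: M] x by [].
  by rewrite -sumU => -[u Uu [v Uv <-]]; exists v => //; exists u; rewrite 1?addrC.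
- by rewrite splitting_perpK// setIC.
Qed.

Lemma perp_set0 : perp b [set 0] = [set: M].
Proof.
by apply/seteqP; split=> // x _ y ->; rewrite /Defs.orthogonal innerC inner0l.
Qed.

Lemma splitting_set0 : splitting b [set (0 : M)].
Proof.
split.
- split; first split; rewrite ?inE//.
    by move=> x y; rewrite !inE => -> ->; rewrite addr0.
  by move=> a x; rewrite !inE => ->; rewrite scaler0.
- rewrite perp_set0; apply/seteqP; split=> // x _.
  by exists 0 => //; exists x; rewrite ?add0r.
- by rewrite perp_set0 setIT.
Qed.

Lemma splitting_setT : splitting b [set: M].
Proof. by rewrite -perp_set0; exact: splitting_perp splitting_set0. Qed.

End Basis.

Theorem corollary3p4 (S : comPzSemiRingType) (M : lSemiModType S)
    (I : choiceType) (b : I -> M) (hb : is_basis b) :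
  is_orthoposet (Ls b) (fun U W : set M => U `<=` W) (perp b)
    [set (0 : M)] [set: M].
Proof.
have Ls0 : Ls b [set 0] := splitting_set0 hb.
have LsT : Ls b [set: M] := splitting_setT hb.
have zero_sub U : Ls b U -> [set 0] `<=` U.
  by move=> [[[U0 _] _] _ _] x ->; rewrite inE in U0.
split.
- split=> //; last by move=> U /zero_sub.
  split=> [U _|U W _ _ UW WU|U V W _ _ _]; first exact: subset_refl.
    by apply/seteqP; split.
  exact: subset_trans.
- by move=> U; exact: splitting_perp.
- by move=> U W _ _; exact: perp_antitone.
- by move=> U; exact: splitting_perpK.
(* An upper bound [W] of U and U^perp is closed under addition, so it contains U + U^perp = M. *)
- move=> U [_ sumU _]; split=> // W [[[_ WD] _] _ _] UW U'W.
  rewrite -sumU => _ [u Uu [v Uv <-]].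
  have := WD u v; rewrite !inE; apply; [exact: UW|exact: U'W].
- move=> U sU; have [_ _ capU] := sU; split=> //.
  + exact: zero_sub.
  + by apply: zero_sub; exact: splitting_perp.
  (* A lower bound of U and U^perp lies in their intersection, which is {0}. *)
  + by move=> W _ WU WU'; rewrite -capU => x Wx; split; [exact: WU|exact: WU'].
Qed.
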